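(* For every accuracy parameter $M>0$ there exist constants $\alpha(M)>0$ and $C(M)>0$, depending only on $M$, such that the following holds. Let $N\ge2$ be an integer, let $0<\tau<1$, let $f\in\mathbb{C}^N$ be a fixed discrete signal, and let $\Omega\subseteq\mathbb{Z}_N$ be the random set of frequencies obtained by including each $k\in\mathbb{Z}_N$ independently with probability $\tau$. If $f$ is supported on a set $T\subseteq\mathbb{Z}_N$ with $$|T|\le\alpha(M)\cdot(\log N)^{-1}\cdot\tau N,$$ then with probability at least $1-C(M)N^{-M}$ the minimizer of the problem $$\min_{g\in\mathbb{C}^N}\ \sum_{t\in\mathbb{Z}_N}|g(t)|\quad\text{subject to}\quad \hat g(k)=\hat f(k)\ \text{ for all }k\in\Omega$$ is unique and is equal to $f$.
   Context: $\mathbb{Z}_N=\{0,\dots,N-1\}$. For $f\in\mathbb{C}^N$ the discrete Fourier transform is $\hat f(k)=\sum_{t=0}^{N-1}f(t)e^{-2\pi i kt/N}$, $k\in\mathbb{Z}_N$. A vector is supported on $T$ if it vanishes outside $T$; $|T|$ is the cardinality of $T$. *)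

(* Defs.v *)
From HB Require Import structures.
From mathcomp Require Import all_boot all_order all_algebra.
From mathcomp Require Import complex.
From mathcomp Require Import all_classical all_reals all_analysis.

Set Implicit Arguments.
Unset Strict Implicit.
Unset Printing Implicit Defensive.

Import Order.TTheory GRing.Theory Num.Theory.
Import numFieldNormedType.Exports.

Local Open Scope classical_set_scope.
Local Open Scope ring_scope.

Definition expi (R : realType) (x : R) : R[i] := (cos x +i* sin x)%C.

(* Signals in C^N are functions on Z_N = {0, ..., N-1}; k * t is computed in
   nat, not modulo N. *)
Definition dft (R : realType) (N : nat) (f : {ffun 'I_N -> R[i]}) :
    {ffun 'I_N -> R[i]} :=
  [ffun k : 'I_N =>
     \sum_(t < N) f t * expi (- (2 * pi * (k * t)%:R / N%:R))].

Definition supported_on (R : realType) (N : nat) (f : {ffun 'I_N -> R[i]})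
    (T : {set 'I_N}) : Prop :=
  forall t, t \notin T -> f t = 0.

(* The modulus is taken in R; the generic `|z| of z : R[i] lives in R[i]. *)
Definition l1norm (R : realType) (N : nat) (g : {ffun 'I_N -> R[i]}) : R :=
  \sum_(t < N) ComplexField.Normc.normc (g t).

Definition feasible (R : realType) (N : nat) (f : {ffun 'I_N -> R[i]})
    (W : {set 'I_N}) : set {ffun 'I_N -> R[i]} :=
  [set g | forall k, k \in W -> dft g k = dft f k].

Definition l1_minimizers (R : realType) (N : nat) (f : {ffun 'I_N -> R[i]})
    (W : {set 'I_N}) : set {ffun 'I_N -> R[i]} :=
  [set g | feasible f W g /\
           forall h, feasible f W h -> l1norm g <= l1norm h].

Definition independent_events (R : realType) (d : measure_display)
    (S : measurableType d) (P : probability S R) (I : finType)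
    (E : I -> set S) : Prop :=
  (forall i, measurable (E i)) /\
  (forall J : {set I},
     P (\bigcap_(i in [set` J]) E i) = (\prod_(i in J) P (E i))%E).

(* Measurability of a random set, as a map to the finite type {set I}, is
   measurability of the inclusion events, required by independent_events. *)
Definition bernoulli_random_set (R : realType) (d : measure_display)
    (S : measurableType d) (P : probability S R) (I : finType) (tau : R)
    (Omega : S -> {set I}) : Prop :=
  independent_events P (fun k : I => [set w | k \in Omega w]) /\
  (forall k : I, P [set w | k \in Omega w] = tau%:E).

(* Main.v *)
Require Import Defs.
From mathcomp Require Import all_boot all_order all_algebra.
From mathcomp Require Import complex.
From mathcomp Require Import all_classical all_reals all_analysis.
From mathcomp Require Import ring lra zify.

Set Implicit Arguments.
Unset Strict Implicit.
Unset Printing Implicit Defensive.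

Import Order.TTheory GRing.Theory Num.Theory.
Import numFieldNormedType.Exports.

Local Open Scope classical_set_scope.
Local Open Scope ring_scope.

(* A randomized Kaczmarz iteration builds a dual certificate.  Fix a target [v]
   on [T] with entries of modulus at most 1.  For uniform independent
   frequencies [k], subtract from the current residual [u] a damped multiple of
   the character [char k], the coefficient being that of the restriction of [u]
   to [T].  On [T] the energy never increases and decreases on average by the
   factor 1 - 1/|T| up to the damping; off [T] the increments average to zero by
   orthogonality of characters.  The damping is proportional to 1/(1 + rho),
   where rho is log N times the normalized size of the residual on [T]: every
   increment off [T] is then O(1/log N) with variance O(1/(|T| log^2 N)), so
   that after O(|T| log N) steps an exponential moment bound keeps the residual
   below 1/2 off [T], while the potential rho^2 exp(2 rho), which starts at a
   power of N, contracts by a constant factor every O(|T|) steps and ends below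
   any power of 1/N.  Both events fail with probability O(N^-M) only.

   Doing this with the same draws for the conjugate sign of [f] and for each
   point mass on [T] yields certificates that force uniqueness: the point masses
   bound a kernel vector on [T] by its values off [T], and the sign pattern then
   makes the l1 norm grow strictly.  Exact recovery is monotone in the set of
   observed frequencies, so a Bernoulli set, which has at least as many elements
   as there are draws outside an event of probability O(N^-M), does at least as
   well as the draws. *)

Lemma eq_ler (R : numDomainType) (x y : R) : x = y -> x <= y.
Proof. by move=> ->. Qed.

(** * Characters and the discrete Fourier transform *)

Lemma expiD (R : realType) (x y : R) : expi (x + y) = expi x * expi y.
Proof.
rewrite /expi cosD sinD; apply/eqP; rewrite eq_complex /= eqxx /=.
by rewrite addrC.
Qed.

Lemma expi0 (R : realType) : expi (0 : R) = 1.
Proof. by rewrite /expi cos0 sin0. Qed.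

Lemma expiX (R : realType) (x : R) n : expi x ^+ n = expi (n%:R * x).
Proof.
elim: n => [|n IHn]; first by rewrite expr0 mul0r expi0.
by rewrite exprSr IHn -expiD -natr1 mulrDl mul1r.
Qed.

Lemma expi_conj (R : realType) (x : R) : ((expi x)^*)%C = expi (- x).
Proof. by rewrite /expi cosN sinN. Qed.

Lemma expi_2pi_nat (R : realType) (n : nat) : expi (2 * pi * n%:R : R) = 1.
Proof.
rewrite mulrC -expiX mulr_natl /expi cos2pi sin2pi.
exact: expr1n.
Qed.

Lemma expi_neq1 (R : realType) (x : R) : 0 < x < 1 -> expi (2 * pi * x) != 1.
Proof.
move=> /andP[x0 x1]; rewrite eq_complex /=; apply/negP => /andP[/eqP c1 _].
have : 0 < sin (pi * x).
  by rewrite sin_gt0_pi// mulr_gt0 ?pi_gt0//= -[ltRHS]mulr1 ltr_pM2l// pi_gt0.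
have := cos2Dsin2 (pi * x).
have := cos_mulr2n (pi * x).
rewrite (_ : (pi * x) *+ 2 = 2 * pi * x) ?c1; last by ring.
move=> h h2 h3; nra.
Qed.

Lemma expi_neq1_norm (R : realType) (x : R) :
  0 < `|x| < 1 -> expi (2 * pi * x) != 1.
Proof.
have [x0|x0] := ger0P x; first exact: expi_neq1.
move=> /expi_neq1; apply: contraNneq => h.
by rewrite mulrN -expi_conj h; apply/eqP; exact: rmorph1.
Qed.

(** The squared modulus, kept real-valued and polynomial in the coordinates so that identities fall
    to [ring]. *)
Definition csq (R : realType) (z : R[i]) : R :=
  complex.Re z ^+ 2 + complex.Im z ^+ 2.

Lemma csq_ge0 (R : realType) (z : R[i]) : 0 <= csq z.
Proof. by rewrite addr_ge0 ?sqr_ge0. Qed.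

Lemma csq0 (R : realType) : csq (0 : R[i]) = 0.
Proof. by rewrite /csq /= expr0n /= addr0. Qed.

Lemma csqE (R : realType) (z : R[i]) : z * (z^*)%C = (csq z)%:C%C.
Proof.
case: z => a b; apply/eqP; rewrite /csq eq_complex /=.
by apply/andP; split; apply/eqP; ring.
Qed.

Lemma csqM (R : realType) (z w : R[i]) : csq (z * w) = csq z * csq w.
Proof. by case: z => a b; case: w => c d; rewrite /csq /=; ring. Qed.

Lemma csq_conj (R : realType) (z : R[i]) : csq (z^*)%C = csq z.
Proof. by case: z => a b; rewrite /csq /= sqrrN. Qed.

Lemma csq_expi (R : realType) (x : R) : csq (expi x) = 1.
Proof. exact: cos2Dsin2. Qed.

Lemma normc_csq (R : realType) (z : R[i]) :
  ComplexField.Normc.normc z = Num.sqrt (csq z).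
Proof. by case: z. Qed.

Lemma csqB (R : realType) (e : R) (x y : R[i]) :
  csq (x - e%:C%C * y) =
    csq x - 2 * e * complex.Re (x * (y^*)%C) + e ^+ 2 * csq y.
Proof. by case: x => a b; case: y => c d; rewrite /csq /=; ring. Qed.

Lemma Re_sum (R : realType) (I : Type) (r : seq I) (P : pred I)
    (F : I -> R[i]) :
  complex.Re (\sum_(i <- r | P i) F i) = \sum_(i <- r | P i) complex.Re (F i).
Proof. by apply: big_morph => // -[a b] [c d]. Qed.

Lemma Re_le_csq (R : realType) (z : R[i]) (b : R) :
  0 <= b -> csq z <= b ^+ 2 -> complex.Re z <= b.
Proof.
case: z => x y b0; rewrite /csq /= => h.
have [//|bx] := leP x b.
have := sqr_ge0 y => y0; nra.
Qed.

Lemma Re_sqr_le_csq (R : realType) (z : R[i]) : complex.Re z ^+ 2 <= csq z.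
Proof. by rewrite lerDl sqr_ge0. Qed.



Section Characters.
Context {R : realType} {N : nat}.
Implicit Types (k t : 'I_N) (u : {ffun 'I_N -> R[i]}) (T : {set 'I_N}).

Definition char k t : R[i] := expi (- (2 * pi * (k * t)%:R / N%:R)).

(** The inner product of [u] with [char k] on [T]. The conjugate sits here and not on the character
    subtracted in [step], since the bilinear pairing of [h] with [char k] is exactly [dft h k]. *)
Definition coef T u k : R[i] := \sum_(t in T) u t * ((char k t)^*)%C.

Lemma csq_char k t : csq (char k t) = 1.
Proof. exact: csq_expi. Qed.

Lemma dftE u k : dft u k = \sum_t u t * char k t.
Proof. by rewrite ffunE. Qed.

Lemma char_orthogonal t j :
  \sum_k ((char k t)^*)%C * char k j = if t == j then N%:R else 0.
Proof.
have N0 : (0 < N)%N by apply: leq_ltn_trans (ltn_ord t).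
have NR0 : N%:R != 0 :> R by rewrite pnatr_eq0 -lt0n.
pose x : R := (t%:R - j%:R) / N%:R.
have charE k : ((char k t)^*)%C * char k j = expi (2 * pi * x) ^+ k.
  rewrite /char expi_conj -expiD expiX; congr expi.
  by rewrite /x !natrM; field.
under eq_bigr do rewrite charE.
have [tj|tj] := eqVneq t j.
  rewrite /x tj subrr mul0r mulr0 expi0.
  under eq_bigr do rewrite expr1n.
  by rewrite sumr_const card_ord.
have x1 : expi (2 * pi * x) != 1.
  apply: expi_neq1_norm; rewrite /x normrM normfV (ger0_norm (ler0n _ N)).
  have NR : 0 < N%:R :> R by rewrite ltr0n.
  rewrite divr_gt0 ?normr_gt0 ?subr_eq0 ?eqr_nat//=.
  rewrite ltr_pdivrMr// mul1r ltr_norml.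
  have tN : t%:R < N%:R :> R by rewrite ltr_nat.
  have jN : j%:R < N%:R :> R by rewrite ltr_nat.
  have := ler0n R t; have := ler0n R j => j0 t0.
  by apply/andP; split; lra.
rewrite -subr_eq0 in x1; apply: (mulfI x1); rewrite mulr0 -subrX1 expiX.
apply/eqP; rewrite subr_eq0; apply/eqP.
(* The N-th power of the ratio is [expi (2 * pi * (t - j))]. Multiplying by [expi (2 * pi * j) = 1]
   reduces it to a natural multiple of the period. *)
rewrite -[RHS](expi_2pi_nat _ t) -[LHS]mulr1 -{1}(expi_2pi_nat _ j) -expiD.
by congr expi; rewrite /x; field.
Qed.

Lemma fourier_inversion T u j :
  \sum_k coef T u k * char k j = N%:R * (if j \in T then u j else 0).
Proof.
under eq_bigr do rewrite mulr_suml.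
rewrite exchange_big /=.
under eq_bigr => t _.
  under eq_bigr do rewrite -mulrA.
  rewrite -mulr_sumr char_orthogonal; over.
rewrite big_mkcond (bigD1 j) /=; last by [].
rewrite eqxx big1 ?addr0; last by move=> t /negPf tj; rewrite tj mulr0 if_same.
by case: ifP => _; rewrite ?mulr0 // mulrC.
Qed.

Definition energy T u : R := \sum_(t in T) csq (u t).

Lemma energy_ge0 T u : 0 <= energy T u.
Proof. by apply: sumr_ge0 => t _; exact: csq_ge0. Qed.

Lemma parseval T u : \sum_k csq (coef T u k) = N%:R * energy T u.
Proof.
apply: (@complexI R); rewrite rmorphM rmorph_nat /energy !rmorph_sum /=.
transitivity (\sum_k \sum_(t in T) (u t)^*%C * (coef T u k * char k t)).
  apply: eq_bigr => k _; rewrite -csqE {2}/coef rmorph_sum mulr_sumr.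
  apply: eq_bigr => t _; rewrite rmorphM mulrCA.
  by congr (_ * _); congr (_ * _); exact: conjcK.
rewrite exchange_big mulr_sumr; apply: eq_bigr => t tT /=.
by rewrite -mulr_sumr fourier_inversion tT -csqE; ring.
Qed.

End Characters.

(** * The damped Kaczmarz step *)

(** On [0, 1], exp(-x) <= 1/(1 + x) <= 1 - x/2. *)
Lemma expR_le_chord (R : realType) (x : R) :
  0 <= x <= 1 -> expR (- x) <= 1 - x / 2.
Proof.
move=> /andP[x0 x1]; have e1 : 1 + x <= expR x := expR_ge1Dx x.
have : expR x * expR (- x) = 1 by exact: expRxMexpNx_1.
have := expR_gt0 (- x); move: (expR x) (expR (- x)) e1 => y z e1 z0 yz.
have : (1 + x) * z <= 1 by rewrite -[leRHS]yz ler_wpM2r// ltW.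
nra.
Qed.

(** Here exp(x) <= 1/(1 - x), and (1 + x + 2x^2)(1 - x) = 1 + x^2(1 - 2x) >= 1. Negative x of any
    size is covered. *)
Lemma expR_le_quadratic (R : realType) (x : R) :
  x <= 1 / 2 -> expR x <= 1 + x + 2 * x ^+ 2.
Proof.
move=> x1; have e1 := expR_ge1Dx (- x).
have : expR x * expR (- x) = 1 by exact: expRxMexpNx_1.
have := expR_gt0 x; move: (expR x) (expR (- x)) e1 => y z e1 y0 yz.
have h : y * (1 - x) <= 1 by rewrite -[leRHS]yz ler_wpM2l// ltW.
have h2 : 1 <= (1 + x + 2 * x ^+ 2) * (1 - x).
  have := sqr_ge0 x; nra.
rewrite -(@ler_pM2r _ (1 - x)); last by lra.
exact: le_trans h h2.
Qed.

(* [r] decreases like sqrt(1 - x) when [r] is small, and by a fixed fraction of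
   [x] when [r] is large; the weight [expR (2 * r)] makes the second regime
   contract at the rate of the first. *)
Lemma potential_contract (R : realType) (r r' x : R) :
  0 <= r -> 0 <= r' -> 0 <= x <= 1 ->
  r' ^+ 2 <= r ^+ 2 * (1 - x / (1 + r)) ->
  r' ^+ 2 * expR (2 * r') <= (1 - x / 2) * (r ^+ 2 * expR (2 * r)).
Proof.
move=> r0 r'0 x01 h; have /andP[x0 x1] := x01.
have r1 : 0 < 1 + r by lra.
set y := x / (1 + r) in h.
have yE : y * (1 + r) = x by rewrite /y divfK// gt_eqF.
have y0 : 0 <= y by rewrite divr_ge0// ltW.
have y1 : y <= 1 by nra.
have h1 : r' <= r * (1 - y / 2).
  rewrite -(@ler_pXn2r _ 2) ?nnegrE//; last by rewrite mulr_ge0//; lra.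
  apply: (le_trans h); rewrite exprMn ler_wpM2l ?sqr_ge0//.
  have := sqr_ge0 y; nra.
have e1 : expR (2 * r') <= expR (2 * r) * expR (- (r * y)).
  by rewrite -expRD ler_expR; lra.
have e2 : r' ^+ 2 <= r ^+ 2 * expR (- y).
  apply: (le_trans h); rewrite ler_wpM2l ?sqr_ge0//.
  exact: (expR_ge1Dx (- y)).
apply: (@le_trans _ _ (r ^+ 2 * expR (- y) *
    (expR (2 * r) * expR (- (r * y))))).
  by apply: ler_pM; rewrite ?sqr_ge0 ?expR_ge0.
(* The factor exp(-y) gained by r^2 and exp(-ry) gained by the weight multiply to exp(-x), because
   y(1 + r) = x whatever the size of r. *)
have -> : r ^+ 2 * expR (- y) * (expR (2 * r) * expR (- (r * y))) =
    expR (- x) * (r ^+ 2 * expR (2 * r)).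
  by rewrite -yE mulrDr mulr1 opprD expRD (mulrC r y); ring.
by rewrite ler_wpM2r ?mulr_ge0 ?sqr_ge0 ?expR_ge0 ?expR_le_chord.
Qed.

Section Kaczmarz.
Context {R : realType} {N : nat}.
Variables (A : R) (T : {set 'I_N}).
Hypotheses (A_gt0 : 0 < A) (T_gt0 : (0 < #|T|)%N).
Implicit Types (k t : 'I_N) (u : {ffun 'I_N -> R[i]}).

Local Notation s := (#|T|%:R : R).

Definition rho u : R := A * Num.sqrt (energy T u / s).

(* The damping [1 + rho u] keeps every increment below [1 / A]. *)
Definition rate u : R := (s * (1 + rho u))^-1.

Definition step u k : {ffun 'I_N -> R[i]} :=
  [ffun t => u t - (rate u)%:C%C * (coef T u k * char k t)].

Definition potential u : R := rho u ^+ 2 * expR (2 * rho u).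

Let s_gt0 : 0 < s. Proof. by rewrite ltr0n. Qed.

Let N_gt0 : 0 < N%:R :> R.
Proof.
rewrite ltr0n; apply: leq_trans T_gt0 _.
by rewrite -[leqRHS]card_ord max_card.
Qed.

Lemma rho_ge0 u : 0 <= rho u.
Proof. by rewrite mulr_ge0 ?sqrtr_ge0// ltW. Qed.

Lemma rho1_gt0 u : 0 < 1 + rho u.
Proof. by rewrite ltr_wpDr ?rho_ge0. Qed.

Lemma rho_sqr u : rho u ^+ 2 = A ^+ 2 * (energy T u / s).
Proof. by rewrite exprMn sqr_sqrtr// divr_ge0 ?energy_ge0// ltW. Qed.

Lemma rate_gt0 u : 0 < rate u.
Proof. by rewrite invr_gt0 mulr_gt0 ?rho1_gt0. Qed.

(** Expanding the square, the cross terms sum over [T] to the squared modulus of the coefficient;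
    characters of modulus 1 give the factor [s] in the quadratic term. *)
Lemma energy_sub e u k :
  energy T [ffun t => u t - e%:C%C * (coef T u k * char k t)] =
    energy T u - (2 * e - e ^+ 2 * s) * csq (coef T u k).
Proof.
rewrite /energy; under eq_bigr => t _.
  rewrite ffunE csqB csqM csq_char mulr1 rmorphM mulrCA; over.
rewrite big_split sumrB /= -mulr_sumr -Re_sum -mulr_sumr -/(coef T u k).
by rewrite [_^*%C * _]mulrC csqE /= sumr_const -mulr_natr; ring.
Qed.

(** Cauchy-Schwarz, read off from the nonnegative energy left by the undamped projection, of rate
    1/s. *)
Lemma csq_coef_le u k : csq (coef T u k) <= s * energy T u.
Proof.
have := energy_ge0 T [ffun t => u t - (s^-1)%:C%C * (coef T u k * char k t)].
rewrite energy_sub.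
rewrite (_ : 2 * s^-1 - s^-1 ^+ 2 * s = s^-1); last by field; rewrite gt_eqF.
by rewrite subr_ge0 mulrC ler_pdivrMr// mulrC.
Qed.

Lemma potential_step u k :
  potential (step u k) <=
    (1 - csq (coef T u k) / (s * energy T u) / 2) * potential u.
Proof.
have S0 := energy_ge0 T u.
set c := csq (coef T u k); have c0 : 0 <= c := csq_ge0 _.
have cS : c <= s * energy T u := csq_coef_le u k.
have r0 := rho_ge0 u.
(* As [rate u * s <= 1], the gain 2e - e^2 s is at least e. *)
have E : energy T (step u k) <= energy T u - rate u * c.
  rewrite energy_sub -/c lerD2l lerN2 ler_wpM2r//.
  have e0 := rate_gt0 u.
  have : rate u * s <= 1.
    rewrite /rate invfM mulrAC mulVf ?gt_eqF// mul1r invf_le1; lra.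
  nra.
(* The contraction parameter lies in [0, 1] by [csq_coef_le]; at zero energy it is 0, the value of a
   division by 0. *)
apply: potential_contract; rewrite ?rho_ge0//.
  have [->|S_neq0] := eqVneq (energy T u) 0.
    by rewrite mulr0 invr0 mulr0 lexx ler01.
  have S_gt0 : 0 < energy T u by rewrite lt_neqAle eq_sym S_neq0.
  by rewrite divr_ge0 ?mulr_ge0 ?ler0n//= ler_pdivrMr ?mul1r// mulr_gt0.
rewrite !rho_sqr -mulrA ler_wpM2l ?sqr_ge0// mulrAC.
rewrite ler_wpM2r ?invr_ge0 ?ler0n//.
apply: (le_trans E).
have [SE|S_neq0] := eqVneq (energy T u) 0.
  by rewrite SE mul0r add0r oppr_le0 mulr_ge0// ltW// rate_gt0.
rewrite [leRHS](_ : _ = energy T u - rate u * c)// /rate; field.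
by rewrite S_neq0 !lt0r_neq0 ?rho1_gt0.
Qed.

(** By Parseval the contraction parameter of [potential_step] averages to 1/s over the
    frequencies. *)
Lemma potential_mean u :
  \sum_k potential (step u k) <= N%:R * expR (- (2 * s)^-1) * potential u.
Proof.
have P0 : 0 <= potential u by rewrite mulr_ge0 ?sqr_ge0 ?expR_ge0.
apply: (le_trans (ler_sum _ (fun k _ => potential_step u k))).
rewrite -mulr_suml sumrB -!mulr_suml sumr_const card_ord parseval.
have [SE|S_neq0] := eqVneq (energy T u) 0.
  by rewrite /potential rho_sqr SE mul0r mulr0 mul0r !mulr0.
rewrite ler_wpM2r//.
have -> : N%:R - N%:R * energy T u / (s * energy T u) / 2 =
    N%:R * (1 - (2 * s)^-1).
  by field; rewrite S_neq0 gt_eqF.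
by rewrite ler_wpM2l ?ler0n// expR_ge1Dx.
Qed.

(** In terms of [rho] the ratio of the two sides is rho^2/(1 + rho)^2, so the damping gives a bound
    uniform in [u]. It controls both the size and the variance of an increment. *)
Lemma rate_sqr_energy u : rate u ^+ 2 * energy T u <= (A ^+ 2 * s)^-1.
Proof.
have r0 := rho_ge0 u.
have SE : energy T u = rho u ^+ 2 * s / A ^+ 2.
  by rewrite rho_sqr; field; rewrite !gt_eqF.
have -> : rate u ^+ 2 * energy T u =
    (A ^+ 2 * s)^-1 * (rho u ^+ 2 / (1 + rho u) ^+ 2).
  by rewrite /rate SE; field; rewrite !lt0r_neq0 ?rho1_gt0.
rewrite ler_piMr ?invr_ge0 ?mulr_ge0 ?(ltW A_gt0)//.
rewrite ler_pdivrMr ?exprn_gt0 ?rho1_gt0// mul1r ler_pXn2r ?nnegrE//; lra.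
Qed.

Lemma csq_increment_le u k z t : csq z = 1 ->
  csq (z * ((rate u)%:C%C * (coef T u k * char k t))) <= A^-1 ^+ 2.
Proof.
move=> z1; rewrite !csqM z1 csq_char mul1r mulr1.
rewrite {1}/csq /= expr0n addr0.
apply: (@le_trans _ _ (s * (rate u ^+ 2 * energy T u))).
  by rewrite mulrCA ler_wpM2l ?sqr_ge0// csq_coef_le.
apply: (le_trans (ler_wpM2l (ler0n _ _) (rate_sqr_energy u))).
by rewrite invfM mulrCA mulfV ?gt_eqF// mulr1 exprVn.
Qed.

(* Off [T] the increments average to zero by [fourier_inversion]. *)
Lemma expR_step_mean (l : R) u z t : csq z = 1 -> t \notin T ->
    0 <= l -> l / A <= 1 / 2 ->
  \sum_k expR (l * complex.Re (z * step u k t)) <=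
    N%:R * expR (2 * (l / A) ^+ 2 / s) * expR (l * complex.Re (z * u t)).
Proof.
move=> z1 tT l0 lA.
pose d k : R := complex.Re (z * ((rate u)%:C%C * (coef T u k * char k t))).
have dE k : expR (l * complex.Re (z * step u k t)) =
    expR (- (l * d k)) * expR (l * complex.Re (z * u t)).
  rewrite -expRD /step ffunE mulrBr; congr expR.
  rewrite [complex.Re (_ - _)](_ : _ = complex.Re (z * u t) - d k).
    by ring.
  by rewrite /d; move: (z * u t) (z * (_ * _)) => [a b] [a' b'].
under eq_bigr do rewrite dE.
rewrite -mulr_suml ler_wpM2r ?expR_ge0//.
have d_le k : - d k <= A^-1.
  rewrite /d (_ : - _ =
      complex.Re (- z * ((rate u)%:C%C * (coef T u k * char k t)))).
    apply: Re_le_csq; first by rewrite invr_ge0 ltW.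
    by apply: csq_increment_le; case: (z) z1 => a b; rewrite /csq /= !sqrrN.
  by rewrite mulNr; case: (z * _).
have le_quad k : expR (- (l * d k)) <= 1 + - l * d k + 2 * l ^+ 2 * d k ^+ 2.
  apply: (le_trans (expR_le_quadratic _)); last by apply: eq_ler; ring.
  by rewrite -mulrN; apply: le_trans lA; rewrite ler_wpM2l.
apply: (le_trans (ler_sum _ (fun k _ => le_quad k))).
rewrite !big_split /= -!mulr_sumr sumr_const card_ord.
have -> : \sum_k d k = 0.
  rewrite /d -Re_sum -mulr_sumr -mulr_sumr fourier_inversion (negPf tT).
  by rewrite !mulr0.
(* The second moment, by Parseval. *)
have : \sum_k d k ^+ 2 <= N%:R / (A ^+ 2 * s).
  apply: (@le_trans _ _ (\sum_k rate u ^+ 2 * csq (coef T u k))).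
    apply: ler_sum => k _; apply: (le_trans (Re_sqr_le_csq _)).
    by rewrite !csqM z1 csq_char mul1r mulr1 {1}/csq /= expr0n addr0.
  rewrite -mulr_sumr parseval mulrCA ler_wpM2l ?ler0n//.
  exact: rate_sqr_energy.
move=> h; rewrite mulr0 addr0.
apply: (@le_trans _ _ (N%:R * (1 + 2 * (l / A) ^+ 2 / s))); last first.
  by rewrite ler_wpM2l ?ler0n// expR_ge1Dx.
rewrite mulrDr mulr1 lerD2l.
apply: (le_trans (ler_wpM2l _ h)); first by rewrite mulr_ge0 ?sqr_ge0.
apply: eq_ler; field.
by rewrite !gt_eqF.
Qed.

End Kaczmarz.

(** * Exact recovery from certificates *)

Local Notation normc := ComplexField.Normc.normc.

Lemma normc_ge0 (R : realType) (z : R[i]) : 0 <= normc z.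
Proof. by rewrite normc_csq sqrtr_ge0. Qed.

Lemma normc_le (R : realType) (z : R[i]) (b : R) :
  0 <= b -> csq z <= b ^+ 2 -> normc z <= b.
Proof.
by move=> b0 h; rewrite normc_csq -(ger0_norm b0) -sqrtr_sqr ler_wsqrtr.
Qed.

Lemma csq_normc (R : realType) (z : R[i]) : csq z = normc z ^+ 2.
Proof. by rewrite normc_csq sqr_sqrtr// csq_ge0. Qed.

Lemma Re_le_normc (R : realType) (z : R[i]) : complex.Re z <= normc z.
Proof. by apply: Re_le_csq; rewrite ?normc_ge0// csq_normc. Qed.

Lemma ReN_le_normc (R : realType) (z : R[i]) : - complex.Re z <= normc z.
Proof.
rewrite (_ : - _ = complex.Re (- z)); last by case: z.
by apply: (le_trans (Re_le_normc _)); rewrite (normcN z).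
Qed.

Lemma normc_sum (R : realType) (I : Type) (r : seq I) (P : pred I)
    (F : I -> R[i]) :
  normc (\sum_(i <- r | P i) F i) <= \sum_(i <- r | P i) normc (F i).
Proof.
elim/big_rec2: _ => [|i x y _ h]; first by rewrite normc_csq csq0 sqrtr0.
exact: le_trans (le_normcD _ _) (lerD _ _).
Qed.

Section Recovery.
Context {R : realType} {N : nat}.
Implicit Types (f g h u v : {ffun 'I_N -> R[i]}) (T W : {set 'I_N}).

(* [v - u] is a combination of the characters of frequency in [W]. *)
Definition same_on_kernel W v u : Prop :=
  forall h, (forall k, k \in W -> dft h k = 0) ->
    \sum_t h t * u t = \sum_t h t * v t.

(** The conjugate of the sign of [z]; it vanishes at 0 because the inverse of 0 is 0. *)
Definition csign (z : R[i]) : R[i] := ((normc z)^-1)%:C%C * (z^*)%C.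

Lemma mul_csign z : z * csign z = (normc z)%:C%C.
Proof.
rewrite /csign mulrCA csqE csq_normc -rmorphM expr2 /=.
have [->|z0] := eqVneq (normc z) 0; first by rewrite !mulr0.
by rewrite mulrA mulVf// mul1r.
Qed.

Lemma csq_csign_le1 z : csq (csign z) <= 1.
Proof.
rewrite csqM csq_conj (csq_normc z) {1}/csq /= expr0n addr0 -exprMn.
have [->|z0] := eqVneq (normc z) 0; first by rewrite mulr0 expr0n.
by rewrite mulVf// expr1n.
Qed.

(** The factor [t \in T] makes every target vanish off [T], so the index can run over all of
    [option 'I_N] without a side condition. *)
Definition target f T (i : option 'I_N) : {ffun 'I_N -> R[i]} :=
  if i is Some x then [ffun t => ((t == x) && (t \in T))%:R]
  else [ffun t => csign (f t)].

Lemma csq_target_le1 f T i t : csq (target f T i t) <= 1.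
Proof.
case: i => [x|] /=; rewrite ffunE; last exact: csq_csign_le1.
by case: (_ && _); rewrite /csq /= ?expr1n ?expr0n ?addr0 ?ler01.
Qed.

Lemma target_off f T i t : supported_on f T -> t \notin T -> target f T i t = 0.
Proof.
move=> fT tT; case: i => [x|] /=; rewrite ffunE.
  by rewrite (negPf tT) andbF.
by rewrite fT// /csign rmorph0 mulr0.
Qed.

(** Here [u] is a residual: on [T] it is the error of the certificate, off [T] the certificate
    itself up to sign. The error 1/(4N), summed over at most N points, costs only 1/4. *)
Definition near_certificate T u : Prop :=
  (forall t, t \in T -> csq (u t) <= (1 / (4 * N%:R)) ^+ 2) /\
  (forall t, t \notin T -> csq (u t) <= (1 / 2) ^+ 2).

Lemma pairing_le T u h : near_certificate T u ->
  normc (\sum_t h t * u t) <=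
    1 / (4 * N%:R) * (\sum_(t in T) normc (h t)) +
    1 / 2 * \sum_(t in ~: T) normc (h t).
Proof.
move=> [uT uC]; apply: (le_trans (normc_sum _ _ _)).
rewrite (bigID (mem T)) /= !mulr_sumr lerD//.
  apply: ler_sum => t tT; rewrite ComplexField.Normc.normcM mulrC.
  rewrite ler_wpM2r ?normc_ge0// normc_le ?uT// divr_ge0// mulr_ge0//.
rewrite (eq_bigl (mem (~: T))); last by move=> t; rewrite /= inE.
apply: ler_sum => t; rewrite !inE => tT.
rewrite ComplexField.Normc.normcM mulrC.
by rewrite ler_wpM2r ?normc_ge0// normc_le ?uC.
Qed.

Lemma dftB g f k : dft (g - f) k = dft g k - dft f k.
Proof.
by rewrite !ffunE -sumrB; apply: eq_bigr => t _; rewrite !ffunE mulrBl.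
Qed.

(** On [T], the modulus of f + h dominates the real part of (f + h) csign f, as [csign] has modulus
    at most 1; off [T], f is 0. *)
Lemma l1norm_split f h T : supported_on f T ->
  l1norm f + complex.Re (\sum_t h t * csign (f t)) +
    \sum_(t in ~: T) normc (h t) <= l1norm (f + h).
Proof.
move=> fT; rewrite /l1norm Re_sum [X in _ + X <= _]big_mkcond /= -!big_split /=.
apply: ler_sum => t _; rewrite !ffunE inE.
have [tT|tT] /= := boolP (t \in T).
  rewrite addr0.
  apply: (@le_trans _ _ (complex.Re ((f t + h t) * csign (f t)))).
    rewrite mulrDl mul_csign.
    by case: (h t * _).
  apply: Re_le_csq; first exact: normc_ge0.
  rewrite csqM -csq_normc -[leRHS]mulr1 ler_wpM2l ?csq_ge0//.
  exact: csq_csign_le1.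
by rewrite fT// /csign rmorph0 !mulr0 normc_csq csq0 sqrtr0 !add0r.
Qed.

(* The targets [Some x] control [h] on [T] by its size off [T]; the target
   [None] then gives strict growth of the l1 norm along every [h] in the
   kernel. *)
Lemma exact_recovery f T W : (0 < #|T|)%N -> supported_on f T ->
    (forall i, exists2 u, same_on_kernel W (target f T i) u &
      near_certificate T u) ->
  l1_minimizers f W = [set f].
Proof.
move=> T0 fT cert.
have NR : 1 <= N%:R :> R.
  by rewrite ler1n; apply: leq_trans T0 _; rewrite -[leqRHS]card_ord max_card.
(* Feasible points differ from [f] by a kernel vector, so this gives both minimality and
   uniqueness. *)
suff growth h : (forall k, k \in W -> dft h k = 0) ->
    l1norm (f + h) <= l1norm f -> h = 0.
  have fmin g : feasible f W g -> l1norm f <= l1norm g.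
    move=> fg; rewrite leNgt; apply/negP => gf.
    have h0 : g - f = 0.
      apply: growth => [k kW|]; last by rewrite addrC subrK ltW.
      by rewrite dftB fg// subrr.
    by move: gf; rewrite (subr0_eq h0) ltxx.
  apply/seteqP; split => [g [fg gmin]|_ ->] /=; last by split=> [k|].
  apply: subr0_eq; apply: growth => [k kW|]; first by rewrite dftB fg// subrr.
  by rewrite addrC subrK; apply: gmin => k.
move=> hW hle.
set HT := \sum_(t in T) normc (h t); set HC := \sum_(t in ~: T) normc (h t).
have HT0 : 0 <= HT by apply: sumr_ge0 => t _; exact: normc_ge0.
have HC0 : 0 <= HC by apply: sumr_ge0 => t _; exact: normc_ge0.
have pair i : normc (\sum_t h t * target f T i t) <=
    1 / (4 * N%:R) * HT + 1 / 2 * HC.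
  by have [u uW uT] := cert i; rewrite -uW//; exact: pairing_le.
have point t : t \in T -> normc (h t) <= 1 / (4 * N%:R) * HT + 1 / 2 * HC.
  move=> tT; have := pair (Some t); rewrite (bigD1 t) //= ffunE eqxx tT mulr1.
  rewrite big1 ?addr0// => x /negPf xt.
  by rewrite ffunE xt mulr0.
have sN : #|T|%:R <= N%:R :> R by rewrite ler_nat -[leqRHS]card_ord max_card.
have HT_le : HT <= 1 / 4 * HT + 1 / 2 * N%:R * HC.
  apply: (le_trans (ler_sum _ point)).
  rewrite sumr_const -[_ *+ #|_|]mulr_natl.
  apply: (@le_trans _ _ (N%:R * (1 / (4 * N%:R) * HT + 1 / 2 * HC))).
    rewrite ler_wpM2r// addr_ge0// mulr_ge0// divr_ge0// mulr_ge0//; lra.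
  apply: eq_ler; field.
  by rewrite gt_eqF//; lra.
have HT_le' : 1 / (4 * N%:R) * HT <= 1 / 6 * HC.
  have -> : 1 / (4 * N%:R) * HT = HT / (4 * N%:R) by rewrite mul1r mulrC.
  rewrite ler_pdivrMr; last by lra.
  nra.
(* If the norm does not grow, HC <= HT/(4N) + HC/2 <= HC/6 + HC/2, which forces HC <= 0. *)
have HC_le : HC <= 0.
  have := le_trans (l1norm_split h fT) hle.
  rewrite -/HC -addrA gerDl => h1.
  have := pair None.
  rewrite /=; under eq_bigr do rewrite ffunE.
  have := ReN_le_normc (\sum_t h t * csign (f t)) => h2 h3; lra.
have HCE : HC = 0 by lra.
have HTE : HT = 0 by move: HT_le; rewrite HCE; lra.
apply/ffunP => t; rewrite ffunE; apply: ComplexField.Normc.eq0_normc.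
have nn (x : 'I_N) : true -> 0 <= normc (h x) by move=> _; exact: normc_ge0.
have [tT|tT] := boolP (t \in T).
  move/eqP: HTE; rewrite psumr_eq0 => [/allP/(_ t)|x _]; last exact: nn.
  by rewrite mem_index_enum tT => /(_ isT)/eqP.
move/eqP: HCE; rewrite psumr_eq0 => [/allP/(_ t)|x _]; last exact: nn.
by rewrite mem_index_enum inE tT => /(_ isT)/eqP.
Qed.

(** Extra constraints shrink the feasible set but keep [f] in it; a minimizer for [W'] is then no
    longer than [f], hence a minimizer for [W]. *)
Lemma l1_minimizers_sub f W W' : W \subset W' ->
  l1_minimizers f W = [set f] -> l1_minimizers f W' = [set f].
Proof.
move=> /fintype.subsetP WW' Wf.
have [_ fmin] : l1_minimizers f W f by rewrite Wf.
have sub g : feasible f W' g -> feasible f W g by move=> fg k /WW'; exact: fg.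
apply/seteqP; split => [g [fg gmin]|_ ->] /=; last first.
  by split=> [k//|g /sub]; exact: fmin.
suff: l1_minimizers f W g by rewrite Wf.
split=> [|g' /fmin]; first exact: sub.
by apply: le_trans; apply: gmin => k.
Qed.

End Recovery.

(** * Failure probability for uniform draws *)

Section Draws.
Context {R : realType} {N : nat}.
Implicit Types (F G : seq 'I_N -> R).

(** Expectation over [m] independent uniform draws, as iterated averages in the order in which
    [foldl] consumes them, so that one-step bounds iterate by induction. *)
Fixpoint draw_mean m F : R :=
  if m is m'.+1 then N%:R^-1 * \sum_k draw_mean m' (fun w => F (k :: w))
  else F [::].

Lemma le_draw_mean m F G : (forall w, F w <= G w) ->
  draw_mean m F <= draw_mean m G.
Proof.
elim: m F G => [|m IHm] F G FG /=; first exact: FG.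
by rewrite ler_wpM2l ?invr_ge0 ?ler0n//; apply: ler_sum => k _; apply: IHm.
Qed.

Lemma draw_mean_sum m (I : Type) (r : seq I) (P : pred I)
    (F : I -> seq 'I_N -> R) :
  draw_mean m (fun w => \sum_(i <- r | P i) F i w) =
    \sum_(i <- r | P i) draw_mean m (F i).
Proof.
elim: m F => [//|m IHm] F /=.
by under eq_bigr do rewrite IHm; rewrite exchange_big mulr_sumr.
Qed.

Lemma draw_meanD m F G :
  draw_mean m (fun w => F w + G w) = draw_mean m F + draw_mean m G.
Proof.
elim: m F G => [//|m IHm] F G /=.
by under eq_bigr do rewrite IHm; rewrite big_split mulrDr.
Qed.

Lemma draw_meanM m F c :
  draw_mean m (fun w => F w * c) = draw_mean m F * c.
Proof.
elim: m F => [//|m IHm] F /=.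
by under eq_bigr do rewrite IHm; rewrite -mulr_suml mulrA.
Qed.

Lemma draw_mean_foldl (U : Type) (next : U -> 'I_N -> U) (Q : U -> R) (c : R)
    (m : nat) (u : U) :
    (0 < N)%N -> 0 <= c ->
    (forall u', \sum_k Q (next u' k) <= N%:R * c * Q u') ->
  draw_mean m (fun w => Q (foldl next u w)) <= c ^+ m * Q u.
Proof.
move=> N0 c0 Qc; have NR : 0 < N%:R :> R by rewrite ltr0n.
elim: m u => [|m IHm] u /=; first by rewrite expr0 mul1r.
rewrite ler_pdivrMl//.
apply: (le_trans (ler_sum _ (fun k _ => IHm (next u k)))).
rewrite -mulr_sumr exprS.
apply: (le_trans (ler_wpM2l (exprn_ge0 _ c0) (Qc u))).
by apply: eq_ler; ring.
Qed.

End Draws.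

Section DrawFailure.
Context {R : realType} {N : nat}.
Implicit Types (f h u v : {ffun 'I_N -> R[i]}) (T W : {set 'I_N}).

Definition failure f W : R := (`[< l1_minimizers f W <> [set f] >])%:R.

Lemma failure_le1 f W : failure f W <= 1.
Proof. by rewrite /failure; case: asbool. Qed.

Lemma failure_ge0 f W : 0 <= failure f W.
Proof. exact: ler0n. Qed.

Lemma failure_sub f W W' : W \subset W' -> failure f W' <= failure f W.
Proof.
move=> WW'; rewrite /failure ler_nat; case: asboolP => // W'f.
by case: asboolP => // /contrapT /(l1_minimizers_sub WW').
Qed.

(** The units 1, -1, i, -i: they reduce a modulus bound to four one-sided bounds, each accessible to
    an exponential moment. *)
Definition direction (b : bool * bool) : R[i] :=
  (-1) ^+ b.1 * (if b.2 then (0 +i* 1)%C else 1).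

Lemma csq_direction b : csq (direction b) = 1.
Proof. by case: b => [] [] [] ; rewrite /direction /csq /=; ring. Qed.

Lemma csq_direction_lt (r : R) (z : R[i]) :
    (forall b, complex.Re (direction b * z) < r) -> csq z <= 2 * r ^+ 2.
Proof.
move=> h; have := h (false, false); have := h (true, false).
have := h (false, true); have := h (true, true).
case: z {h} => x y; rewrite /direction /csq /= => h1 h2 h3 h4.
have {}h1 : y < r by apply: le_lt_trans h1; apply: eq_ler; ring.
have {}h2 : - y < r by apply: le_lt_trans h2; apply: eq_ler; ring.
have {}h3 : - x < r by apply: le_lt_trans h3; apply: eq_ler; ring.
have {}h4 : x < r by apply: le_lt_trans h4; apply: eq_ler; ring.
nra.
Qed.

Lemma same_on_kernel_foldl A T W v (w : seq 'I_N) :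
  {subset w <= W} -> same_on_kernel W v (foldl (step A T) v w).
Proof.
elim/last_ind: w => [|w k IHw] wW h hW //=.
rewrite foldl_rcons; set u := foldl _ _ _ in IHw *.
have {}IHw : \sum_t h t * u t = \sum_t h t * v t.
  by apply: IHw => // x xw; apply: wW; rewrite mem_rcons inE xw orbT.
have hk : \sum_t h t * char k t = 0.
  by rewrite -dftE hW// wW// mem_rcons mem_head.
transitivity (\sum_t h t * u t -
    (rate A T u)%:C%C * coef T u k * \sum_t h t * char k t).
  rewrite mulr_sumr -sumrB; apply: eq_bigr => t _.
  by rewrite ffunE; ring.
by rewrite hk mulr0 subr0.
Qed.

Variables (f : {ffun 'I_N -> R[i]}) (T : {set 'I_N}) (A l : R).
Hypotheses (T_gt0 : (0 < #|T|)%N) (fT : supported_on f T).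
Hypotheses (A_gt0 : 0 < A) (l_ge0 : 0 <= l) (lA : l / A <= 1 / 2).

Local Notation s := (#|T|%:R : R).

Let s_gt0 : 0 < s. Proof. by rewrite ltr0n. Qed.

Let N_ge1 : (0 < N)%N.
Proof. by apply: leq_trans T_gt0 _; rewrite -[leqRHS]card_ord max_card. Qed.

Let N_gt0 : 0 < N%:R :> R. Proof. by rewrite ltr0n. Qed.

(** Scaled so that a value below 1 suffices on [T]: the potential is at least [rho ^+ 2], so the
    cost is at least 16 N^2 times the energy. *)
Definition on_cost u : R := potential A T u * (16 * N%:R ^+ 2 * s / A ^+ 2).

(** A union bound over points and directions: a term reaches 1 once its real part reaches 1/4, and 2
    (1/4)^2 <= (1/2)^2. *)
Definition off_cost u : R := \sum_(t in ~: T) \sum_(b : bool * bool)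
  expR (l * complex.Re (direction b * u t)) * expR (- (l / 4)).

Lemma on_cost_lt1 u t : on_cost u < 1 -> t \in T ->
  csq (u t) <= (1 / (4 * N%:R)) ^+ 2.
Proof.
move=> cost tT; apply: (@le_trans _ _ (energy T u)).
  rewrite /energy (bigD1 t) //= lerDl sumr_ge0// => x _; exact: csq_ge0.
have : A ^+ 2 * (energy T u / s) <= potential A T u.
  rewrite -rho_sqr// ler_peMr ?sqr_ge0//.
  by rewrite -[leLHS]expR0 ler_expR mulr_ge0// rho_ge0.
move: cost; rewrite /on_cost => cost h.
have {cost h} : A ^+ 2 * (energy T u / s) * (16 * N%:R ^+ 2 * s / A ^+ 2) < 1.
  apply: le_lt_trans cost; rewrite ler_wpM2r//.
  by rewrite divr_ge0 ?mulr_ge0 ?ler0n// ltW.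
rewrite (_ : _ * _ = energy T u * (16 * N%:R ^+ 2)); last first.
  by field; rewrite !lt0r_neq0.
rewrite -ltr_pdivlMr ?mulr_gt0 ?exprn_gt0// => /ltW h; apply: (le_trans h).
by apply: eq_ler; field; rewrite lt0r_neq0.
Qed.

Lemma off_cost_lt1 u t : off_cost u < 1 -> t \notin T ->
  csq (u t) <= (1 / 2) ^+ 2.
Proof.
move=> cost tT; apply: (@le_trans _ _ (2 * (1 / 4) ^+ 2)); last by lra.
apply: csq_direction_lt => b; rewrite ltNge; apply/negP => big.
move: cost; apply/negP; rewrite -leNgt /off_cost.
have nn x : 0 <= \sum_(b : bool * bool)
    expR (l * complex.Re (direction b * u x)) * expR (- (l / 4)).
  by apply: sumr_ge0 => b' _; rewrite mulr_ge0 ?expR_ge0.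
rewrite (bigD1 t) ?inE//= (bigD1 b)//= -addrA ler_wpDr//.
  by rewrite addr_ge0 ?sumr_ge0// => b' _; rewrite mulr_ge0 ?expR_ge0.
rewrite -expRD -[leLHS]expR0 ler_expR.
have := ler_wpM2l l_ge0 big; lra.
Qed.

Lemma on_cost_ge0 u : 0 <= on_cost u.
Proof.
have h : 0 <= A ^+ 2 by exact: sqr_ge0.
apply: mulr_ge0; first by rewrite mulr_ge0 ?expR_ge0 ?sqr_ge0.
by rewrite divr_ge0// !mulr_ge0.
Qed.

Lemma off_cost_ge0 u : 0 <= off_cost u.
Proof.
by apply: sumr_ge0 => t _; apply: sumr_ge0 => b _; rewrite mulr_ge0 ?expR_ge0.
Qed.

(** Markov's inequality in pointwise form: a total cost below 1 makes the same draws succeed for all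
    targets at once, and otherwise the bound exceeds the indicator. *)
Lemma failure_le_cost (w : seq 'I_N) :
  failure f [set x in w] <=
    \sum_i (on_cost (foldl (step A T) (target f T i) w) +
            off_cost (foldl (step A T) (target f T i) w)).
Proof.
set cost := BIG_F.
have cost_ge0 i : 0 <= cost i by rewrite addr_ge0 ?on_cost_ge0 ?off_cost_ge0.
have [c1|c1] := leP 1 (\sum_i cost i).
  exact: le_trans (failure_le1 _ _) c1.
rewrite /failure; case: asboolP => [|_]; last exact: sumr_ge0.
case; apply: (exact_recovery T_gt0 fT) => i.
exists (foldl (step A T) (target f T i) w).
  by apply: same_on_kernel_foldl => k kw; rewrite inE.
have : cost i < 1.
  by apply: le_lt_trans c1; rewrite (bigD1 i)//= lerDl sumr_ge0.
rewrite /cost => ci.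
split => t; [apply: on_cost_lt1|apply: off_cost_lt1];
  apply: le_lt_trans ci; [rewrite lerDl|rewrite lerDr];
  [exact: off_cost_ge0|exact: on_cost_ge0].
Qed.

Lemma potential_target i :
  potential A T (target f T i) <= A ^+ 2 * expR (2 * A).
Proof.
set v := target f T i.
have vs : energy T v <= s.
  rewrite -sum1_card natr_sum; apply: ler_sum => t _; exact: csq_target_le1.
have r2 : rho A T v ^+ 2 <= A ^+ 2.
  by rewrite rho_sqr// ler_piMr ?sqr_ge0// ler_pdivrMr// mul1r.
have r1 : rho A T v <= A.
  by move: r2; rewrite ler_pXn2r ?nnegrE ?rho_ge0// ltW.
by rewrite ler_pM ?sqr_ge0 ?expR_ge0// ler_expR ler_wpM2l.
Qed.

Lemma draw_mean_failure m :
  draw_mean m (fun w => failure f [set x in w]) <=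
    N.+1%:R * (16 * N%:R ^+ 2 * s * expR (2 * A) * expR (- (2 * s)^-1) ^+ m +
      4 * N%:R * expR (2 * (l / A) ^+ 2 / s) ^+ m * expR (- (l / 4))).
Proof.
apply: (le_trans (le_draw_mean _ failure_le_cost)).
rewrite draw_mean_sum.
set c := (X in N.+1%:R * X).
have -> : N.+1%:R * c = \sum_(i : option 'I_N) c.
  by rewrite sumr_const card_option card_ord mulr_natl.
apply: ler_sum => i _; rewrite {}/c; rewrite draw_meanD; apply: lerD.
  rewrite draw_meanM.
  have := draw_mean_foldl m (target f T i) N_ge1 (expR_ge0 _)
    (potential_mean A_gt0 T_gt0).
  move=> h; apply: (le_trans (ler_wpM2r _ h)).
    by rewrite divr_ge0 ?mulr_ge0 ?ler0n// ltW.
  apply: (@le_trans _ _ (expR (- (2 * s)^-1) ^+ m * (A ^+ 2 * expR (2 * A)) *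
      (16 * N%:R ^+ 2 * s / A ^+ 2))).
    rewrite ler_wpM2r ?divr_ge0 ?mulr_ge0 ?ler0n ?(ltW A_gt0)//.
    by rewrite ler_wpM2l ?exprn_ge0 ?expR_ge0// potential_target.
  apply: eq_ler; field.
  by rewrite lt0r_neq0.
rewrite draw_mean_sum.
apply: (@le_trans _ _ (\sum_(t in ~: T)
    4 * (expR (2 * (l / A) ^+ 2 / s) ^+ m * expR (- (l / 4))))).
  apply: ler_sum => t; rewrite !inE => tT; rewrite draw_mean_sum.
  rewrite [leRHS](_ : _ = \sum_(b : bool * bool)
      (expR (2 * (l / A) ^+ 2 / s) ^+ m * expR (- (l / 4)))); last first.
    by rewrite sumr_const card_prod card_bool -[RHS]mulr_natl.
  apply: ler_sum => b _.
  rewrite draw_meanM ler_wpM2r ?expR_ge0//.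
  have := @draw_mean_foldl R N _ (step A T)
    (fun u => expR (l * complex.Re (direction b * u t))) _ m (target f T i)
    N_ge1 (expR_ge0 _)
    (fun u => expR_step_mean A_gt0 T_gt0 u (csq_direction b) tT l_ge0 lA).
  (* The target vanishes off [T], so the exponential moment starts at 1. *)
  by rewrite target_off// !mulr0 expR0 mulr1.
rewrite sumr_const -[_ *+ _]mulr_natl.
rewrite [leRHS](_ : _ = N%:R *
    (4 * (expR (2 * (l / A) ^+ 2 / s) ^+ m * expR (- (l / 4))))); last by ring.
rewrite ler_wpM2r ?mulr_ge0 ?exprn_ge0 ?expR_ge0// ler_nat.
by rewrite -[leqRHS]card_ord max_card.
Qed.

End DrawFailure.

(** * From uniform draws to Bernoulli sets *)

Section BernoulliVersusDraws.
Context {R : realType} {N : nat}.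
Implicit Types (A W : {set 'I_N}) (k : 'I_N).

Definition bernoulli_weight (tau : R) W : R :=
  \prod_k (if k \in W then tau else 1 - tau).

Lemma sum_prod_if (a b : R) :
  \sum_(W : {set 'I_N}) \prod_(k < N) (if k \in W then a else b) = (a + b) ^+ N.
Proof.
transitivity (\prod_(k < N) (a + b)); last by rewrite prodr_const card_ord.
by rewrite bigA_distr; apply: eq_bigl.
Qed.

Lemma sum_bernoulli_weight tau :
  \sum_(W : {set 'I_N}) bernoulli_weight tau W = 1.
Proof. by rewrite sum_prod_if addrC subrK expr1n. Qed.

Lemma prod_if (a b : R) W :
  \prod_k (if k \in W then a else b) = a ^+ #|W| * b ^+ #|~: W|.
Proof.
rewrite (bigID (mem W)) /=; congr (_ * _).
  rewrite -prodr_const; apply: eq_bigr => k kW; by rewrite kW.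
rewrite -prodr_const; apply: eq_big => k; first by rewrite inE.
by move=> /negPf ->.
Qed.

Lemma bernoulli_weight_ge0 (tau : R) W :
  0 <= tau <= 1 -> 0 <= bernoulli_weight tau W.
Proof.
move=> /andP[t0 t1]; apply: prodr_ge0 => k _; case: ifP => // _.
by rewrite subr_ge0.
Qed.

(** Chernoff bound: 2^(m - #|W|) dominates the indicator of #|W| < m, and the mean of 2^(-#|W|) is
    (1 - tau/2)^N. *)
Lemma bernoulli_tail (tau : R) m : 0 <= tau <= 1 ->
  \sum_(W : {set 'I_N} | (#|W| < m)%N) bernoulli_weight tau W <=
    expR (m%:R - tau * N%:R / 2).
Proof.
move=> t01; have /andP[t0 t1] := t01.
have halfW W : \prod_(k < N) (if k \in W then tau / 2 else 1 - tau) =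
    bernoulli_weight tau W * 2^-1 ^+ #|W|.
  by rewrite /bernoulli_weight !prod_if exprMn; ring.
apply: (@le_trans _ _ (2 ^+ m * \sum_(W : {set 'I_N}) \prod_(k < N)
    (if k \in W then tau / 2 else 1 - tau))).
  rewrite mulr_sumr big_mkcond; apply: ler_sum => W _; rewrite halfW.
  have w0 := bernoulli_weight_ge0 W t01.
  case: ifPn => Wm; last by rewrite !mulr_ge0 ?exprn_ge0// invr_ge0.
  rewrite mulrCA -[leLHS]mulr1 ler_wpM2l//.
  rewrite exprVn -(subnK (ltnW Wm)) exprD -mulrA divff ?mulr1 ?expf_neq0//.
  by rewrite exprn_ege1// ler1n.
rewrite sum_prod_if expRD ler_pM ?exprn_ge0//; first by lra.
  rewrite -[m%:R]mulr1 expRM_natl lerXn2r ?nnegrE ?expR_ge0//.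
  by apply: le_trans (expR_ge1Dx 1); lra.
rewrite [X in expR X](_ : _ = N%:R * - (tau / 2)); last by ring.
rewrite expRM_natl lerXn2r ?nnegrE ?expR_ge0//; first lra.
by apply: le_trans (expR_ge1Dx _); lra.
Qed.

Variable B : {set 'I_N} -> R.
Hypotheses (B_ge0 : forall W, 0 <= B W) (B_le1 : forall W, B W <= 1).
Hypothesis B_anti : forall W W', W \subset W' -> B W' <= B W.

(* The mean of [B] over [A] with [n] distinct uniform frequencies added. *)
Fixpoint fresh_mean n A : R :=
  if n is n'.+1 then
    if #|~: A| == 0%N then B A
    else #|~: A|%:R^-1 * \sum_(k in ~: A) fresh_mean n' (k |: A)
  else B A.

Lemma fresh_mean_full n A : #|~: A| = 0%N -> fresh_mean n A = B A.
Proof. by case: n => [//|n] A0 /=; rewrite A0 eqxx. Qed.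

(** Cleared of its denominator, the recursion also holds when no fresh frequency is left. *)
Lemma fresh_meanS n A : #|~: A|%:R * fresh_mean n.+1 A =
  \sum_(k in ~: A) fresh_mean n (k |: A).
Proof.
rewrite /=; case: eqP => [A0|/eqP A0].
  rewrite A0 mul0r big1// => k kA.
  by move: A0 => /eqP; rewrite cards_eq0 => /eqP A0; rewrite A0 inE in kA.
by rewrite mulrA divff ?mul1r// pnatr_eq0.
Qed.

Lemma fresh_mean_ge0 n A : 0 <= fresh_mean n A.
Proof.
elim: n A => [|n IHn] A //=; case: ifP => // _.
by rewrite mulr_ge0 ?invr_ge0 ?ler0n// sumr_ge0.
Qed.

Lemma fresh_mean_decrS n A : fresh_mean n.+1 A <= fresh_mean n A.
Proof.
have [A0|A0] := eqVneq #|~: A| 0%N; first by rewrite !fresh_mean_full.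
have AR : 0 < #|~: A|%:R :> R by rewrite ltr0n lt0n.
elim: n A A0 AR => [|n IHn] A A0 AR; rewrite -(ler_pM2l AR) !fresh_meanS.
  rewrite mulr_natl -sumr_const; apply: ler_sum => k _.
  exact/B_anti/finset.subsetUr.
apply: ler_sum => k _.
have [kA0|kA0] := eqVneq #|~: (k |: A)| 0%N; first by rewrite !fresh_mean_full.
by apply: IHn => //; rewrite ltr0n lt0n.
Qed.

Lemma fresh_mean_decr m n A : (m <= n)%N -> fresh_mean n A <= fresh_mean m A.
Proof.
move=> /subnK <-; elim: (n - m)%N => [|j IHj]; first by rewrite add0n.
by rewrite addSn; apply: le_trans (fresh_mean_decrS _ _) IHj.
Qed.

(** A draw already in [A] is wasted: it leaves [m] fresh draws, whose mean is no smaller than with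
    [m.+1]. The other draws follow the recursion. *)
Lemma fresh_mean_le_draw_mean m A : (0 < N)%N ->
  fresh_mean m A <= draw_mean m (fun w => B (A :|: [set x in w])).
Proof.
move=> N0; have NR : 0 < N%:R :> R by rewrite ltr0n.
elim: m A => [|m IHm] A.
  by rewrite /= [X in _ :|: X](_ : _ = finset.set0) ?finset.setU0//;
    apply/setP => x; rewrite !inE.
rewrite [draw_mean _ _]/= ler_pdivlMl//.
apply: (@le_trans _ _ (\sum_k fresh_mean m (k |: A))); last first.
  apply: ler_sum => k _; apply: (le_trans (IHm _)); apply: le_draw_mean => w.
  rewrite [leRHS](_ : _ = B ((k |: A) :|: [set x in w]))//; congr B.
  by apply/setP => x; rewrite !inE; case: (x \in A); case: (x == k).
have U := fresh_meanS m A; have Ule := fresh_mean_decrS m A.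
set U' := fresh_mean m.+1 A in U Ule *.
rewrite (bigID (mem A)) /= (eq_bigr (fun=> fresh_mean m A)); last first.
  by move=> k kA; rewrite (finset.setUidPr _) ?finset.sub1set.
rewrite [X in _ + X](eq_bigl (mem (~: A))) => [|k]; last by rewrite !inE.
rewrite -U sumr_const -[X in X + _]mulr_natl.
have -> : N%:R = #|A|%:R + #|~: A|%:R :> R.
  by rewrite -natrD cardsC card_ord.
by rewrite mulrDl lerD2r ler_wpM2l ?ler0n.
Qed.

(** Identifies [fresh_mean] with the uniform mean over supersets of given size, by double counting:
    each [W] arises from n + 1 choices of the first added element. *)
Lemma layer_sum n A :
  \sum_(W : {set 'I_N} | (A \subset W) && (#|W| == #|A| + n)%N) B W =
    'C(#|~: A|, n)%:R * fresh_mean n A.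
Proof.
elim: n A => [|n IHn] A.
  rewrite bin0 mul1r addn0 (big_pred1 A)// => W.
  rewrite /= [W == A]eq_sym eqEcard.
  case AW: (A \subset W) => //=.
  by rewrite eqn_leq (subset_leq_card AW) andbT.
have n1 : n.+1%:R != 0 :> R by rewrite pnatr_eq0.
apply: (mulfI n1); rewrite mulrA -natrM -mul_bin_diag natrM mulrAC fresh_meanS.
rewrite mulr_suml.
transitivity (\sum_(k in ~: A) \sum_(W : {set 'I_N} |
    (k |: A \subset W) && (#|W| == #|k |: A| + n)%N) B W); last first.
  apply: eq_bigr => k; rewrite inE => kA; rewrite IHn mulrC; congr (_ * _%:R).
  have := cardsC A; have := cardsC (k |: A).
  by rewrite cardsU1 kA => ? ?; congr binomial; lia.
rewrite (exchange_big_dep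
    (fun W => (A \subset W) && (#|W| == #|A| + n.+1)%N)) /=; last first.
  move=> k W; rewrite inE => kA.
  by rewrite finset.subUset cardsU1 kA => /andP[/andP[_ ->]] /=; rewrite addnS.
rewrite mulr_sumr; apply: eq_bigr => W /andP[AW /eqP cW].
rewrite (eq_bigl (mem (W :\: A))) => [|k]; last first.
  rewrite !inE finset.subUset finset.sub1set AW andbT cardsU1.
  by case: (k \in A) => //=; rewrite cW addnS eqxx andbT.
rewrite sumr_const mulr_natl; congr (_ *+ _).
by rewrite cardsD (finset.setIidPr AW) cW addKn.
Qed.

(** Sizes below [m] go to the tail. On each larger size the Bernoulli weight is constant, so the
    mean of [B] there is a [fresh_mean] of at least [m] frequencies. *)
Lemma bernoulli_mean_le m tau : 0 <= tau <= 1 -> (0 < N)%N ->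
  \sum_(W : {set 'I_N}) bernoulli_weight tau W * B W <=
    expR (m%:R - tau * N%:R / 2) + draw_mean m (fun w => B [set x in w]).
Proof.
move=> t01 N0; rewrite (bigID (fun W : {set 'I_N} => (#|W| < m)%N)) /=.
have w0 W := bernoulli_weight_ge0 W t01.
apply: lerD.
  apply: le_trans (bernoulli_tail _ t01); apply: ler_sum => W _.
  by rewrite ler_piMr.
apply: (@le_trans _ _ (fresh_mean m finset.set0)); last first.
  rewrite [leRHS](_ : _ =
      draw_mean m (fun w => B (finset.set0 :|: [set x in w]))).
    exact: fresh_mean_le_draw_mean.
  by congr draw_mean; apply/funext => w; rewrite finset.set0U.
have := sum_bernoulli_weight tau.
rewrite (bigID (fun W : {set 'I_N} => (#|W| < m)%N)) /= => w1.
apply: (@le_trans _ _ (\sum_(W : {set 'I_N} | ~~ (#|W| < m)%N)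
    bernoulli_weight tau W * fresh_mean m finset.set0)); last first.
  rewrite -mulr_suml ler_piMl ?fresh_mean_ge0// -[leRHS]w1 lerDr.
  exact: sumr_ge0.
have card_lt (W : {set 'I_N}) : (#|W| < N.+1)%N.
  by rewrite ltnS -[leqRHS]card_ord max_card.
pose size_of (W : {set 'I_N}) := Ordinal (card_lt W).
rewrite (partition_big size_of predT) //=.
rewrite [leRHS](partition_big size_of predT) //=.
apply: ler_sum => n _.
have [mn|nm] := leqP m n; last first.
  by rewrite !big_pred0// => W; apply/negP => /andP[+ /eqP Wn]; rewrite -leqNgt;
    move: nm; rewrite -Wn /= ltnNge => /negbTE ->.
have layer (F : {set 'I_N} -> R) :
    \sum_(W : {set 'I_N} | ~~ (#|W| < m)%N && (size_of W == n))
      bernoulli_weight tau W * F W =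
    tau ^+ n * (1 - tau) ^+ (N - n) * \sum_(W : {set 'I_N} | #|W| == n) F W.
  rewrite mulr_sumr; apply: eq_big => W.
    by rewrite -val_eqE /=; case: eqP => [->|]; rewrite ?andbF// -leqNgt mn.
  move=> /andP[_]; rewrite -val_eqE /= => /eqP Wn.
  rewrite /bernoulli_weight prod_if (cardsCs (~: W)).
  by rewrite finset.setCK Wn card_ord.
rewrite !layer ler_wpM2l//.
  by move: t01 => /andP[? ?]; rewrite mulr_ge0 ?exprn_ge0// subr_ge0.
rewrite sumr_const.
have := layer_sum n finset.set0.
rewrite cards0 add0n finset.setC0 cardsT card_ord.
under eq_bigl do rewrite finset.sub0set.
move=> ->; rewrite -[leRHS]mulr_natl -cardsE card_draws card_ord.
by rewrite ler_wpM2l ?ler0n// fresh_mean_decr.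
Qed.

End BernoulliVersusDraws.

(** * Random sets on a probability space *)

Section RandomSet.
Context {R : realType} (d : measure_display) (S : measurableType d).
Context (P : probability S R) {N : nat} (tau : R) (Omega : S -> {set 'I_N}).
Hypothesis Omega_bernoulli : bernoulli_random_set P tau Omega.

(** Independence is stated for inclusion events only. Exclusions are listed in a sequence so as to
    be added one at a time, each as a difference of two cylinders. *)
Definition cylinder (J : {set 'I_N}) (V : seq 'I_N) : set S :=
  [set w | (forall k, k \in J -> k \in Omega w) /\
           (forall k, k \in V -> k \notin Omega w)].

Lemma cylinder_nil J :
  cylinder J [::] = \bigcap_(k in [set` J]) [set w | k \in Omega w].
Proof. by apply/seteqP; split => w /= => [[]//|h]; split. Qed.

Lemma cylinder_cons J k V :
  cylinder J (k :: V) = cylinder J V `\` cylinder (k |: J) V.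
Proof.
apply/seteqP; split => w /= [hJ hV].
  split; first by split => // x xV; apply: hV; rewrite inE xV orbT.
  by move=> [/(_ k) + _]; rewrite !inE eqxx => /(_ isT); apply/negP/hV/mem_head.
have [{}hJ hV'] := hJ; split => // x.
rewrite inE => /predU1P[->|]; last exact: hV'.
apply/negP => kw; apply: hV; split => // y; rewrite !inE => /predU1P[->//|].
exact: hJ.
Qed.

Lemma cylinder_measurable J V : measurable (cylinder J V).
Proof.
elim: V J => [|k V IHV] J; last by rewrite cylinder_cons; exact: measurableD.
rewrite cylinder_nil; apply: fin_bigcap_measurable => // k _.
by have [[]] := Omega_bernoulli.
Qed.

Lemma cylinder_prob (J : {set 'I_N}) (V : seq 'I_N) :
    uniq V -> {in V, forall k, k \notin J} ->
  P (cylinder J V) = (tau ^+ #|J| * (1 - tau) ^+ size V)%:E.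
Proof.
elim: V J => [|k V IHV] J /=.
  move=> _ _; have [[_ indep] prob] := Omega_bernoulli.
  rewrite cylinder_nil indep expr0 mulr1 -prodr_const -prodEFin.
  by apply: eq_bigr => k _; exact: prob.
move=> /andP[kV uV] VJ.
have kJ : k \notin J by apply: VJ; exact: mem_head.
have VJ' : {in V, forall x, x \notin J}.
  by move=> x xV; apply: VJ; rewrite inE xV orbT.
have fin : (P (cylinder J V) < +oo)%E by rewrite IHV// ltry.
rewrite cylinder_cons (measureD (cylinder_measurable J V)
  (cylinder_measurable (k |: J) V) fin).
rewrite (_ : _ `&` _ = cylinder (k |: J) V); last first.
  apply/seteqP; split => w /=; first by case.
  move=> [hJ hV]; split; split => // x xJ; apply: hJ.
  by rewrite !inE xJ orbT.
rewrite -[LHS]/(P (cylinder J V) - P (cylinder (k |: J) V))%E.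
rewrite !IHV//; last first.
  move=> x xV; rewrite !inE negb_or VJ' // andbT.
  by apply: contraNneq kV => <-.
by rewrite -EFinB cardsU1 kJ; congr EFin; rewrite add1n !exprS; ring.
Qed.

Lemma random_set_fiber W : [set w | Omega w = W] = cylinder W (enum (~: W)).
Proof.
apply/seteqP; split => w /=.
  by move=> <-; split => // k; rewrite mem_enum inE.
move=> [hW hC]; apply/setP => k; have [kW|kW] := boolP (k \in W).
  exact: hW.
by apply/negbTE/hC; rewrite mem_enum inE.
Qed.

Lemma measurable_random_set (Q : pred {set 'I_N}) :
  measurable [set w | Q (Omega w)].
Proof.
rewrite (_ : [set w | _] = \bigcup_(W in [set W | Q W]) [set w | Omega w = W]).
  apply: fin_bigcup_measurable; first exact: finite_finset.
  by move=> W _; rewrite random_set_fiber; exact: cylinder_measurable.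
by apply/seteqP; split => [w Qw|w [W QW /= ->]//]; exists (Omega w).
Qed.

Lemma random_set_prob W :
  P [set w | Omega w = W] = (bernoulli_weight tau W)%:E.
Proof.
rewrite random_set_fiber cylinder_prob ?enum_uniq//.
  by rewrite /bernoulli_weight prod_if -cardE.
by move=> k; rewrite mem_enum inE.
Qed.

Lemma random_set_prob_le (Q : pred {set 'I_N}) :
  (P [set w | Q (Omega w)] <=
    (\sum_(W : {set 'I_N}) bernoulli_weight tau W * (Q W)%:R)%:E)%E.
Proof.
suff main (r : seq {set 'I_N}) : (P [set w | (Omega w \in r) && Q (Omega w)] <=
    (\sum_(W <- r) bernoulli_weight tau W * (Q W)%:R)%:E)%E.
  apply: le_trans (main (index_enum _)).
  apply: le_measure; rewrite ?inE;
    [| |by move=> w /= ->; rewrite mem_index_enum].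
    exact: measurable_random_set.
  exact: (measurable_random_set (fun W => (W \in _) && Q W)).
elim: r => [|W r IHr].
  by rewrite big_nil (_ : [set _ | _] = set0) ?measure0//; apply/seteqP; split.
have mr : measurable [set w | (Omega w \in r) && Q (Omega w)].
  exact: (measurable_random_set (fun W => (W \in r) && Q W)).
have mWr : measurable [set w | (Omega w \in W :: r) && Q (Omega w)].
  exact: (measurable_random_set (fun W' => (W' \in W :: r) && Q W')).
rewrite big_cons EFinD.
have [QW|QW] := boolP (Q W); last first.
  rewrite mulr0 add0e; apply: le_trans IHr.
  apply: le_measure; rewrite ?inE// => w /=.
  rewrite inE => /andP[/predU1P[->|->]//].
  by rewrite (negPf QW).
have mW : measurable [set w | Omega w = W].
  by rewrite random_set_fiber; exact: cylinder_measurable.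
rewrite mulr1 -random_set_prob.
apply: (@le_trans _ _ (P ([set w | Omega w = W] `|`
    [set w | (Omega w \in r) && Q (Omega w)]))).
  apply: le_measure; rewrite ?inE//; first exact: measurableU.
  by move=> w /=; rewrite inE => /andP[/predU1P[->|->] ->]; [left|right].
by apply: (le_trans (measureU2 _ _ _)) => //; exact: leeD.
Qed.

End RandomSet.

(** * Choice of the constants *)

Lemma ln_nat_ge_half (R : realType) (N : nat) :
  (2 <= N)%N -> 1 / 2 <= ln N%:R :> R.
Proof.
move=> N2; have NR : 2 <= N%:R :> R by rewrite ler_nat.
rewrite -[leLHS]expRK ler_ln ?posrE ?expR_gt0//; last by lra.
have h : expR (1 / 2) <= 1 + 1 / 2 + 2 * (1 / 2) ^+ 2 :> R.
  exact: expR_le_quadratic.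
lra.
Qed.

(** Settles the case of empty [T], where the Kaczmarz estimates do not apply. *)
Lemma l1_minimizers0 (R : realType) (N : nat) (f : {ffun 'I_N -> R[i]}) W :
  (forall t, f t = 0) -> l1_minimizers f W = [set f].
Proof.
move=> f0; have nf : l1norm f = 0.
  by rewrite /l1norm big1// => t _; rewrite f0 normc_csq csq0 sqrtr0.
have nn g : 0 <= l1norm g by apply: sumr_ge0 => t _; exact: normc_ge0.
apply/seteqP; split => [g [_ gmin]|_ ->] /=; last first.
  by split=> [k|h _]; rewrite ?nf ?nn.
have : l1norm g = 0.
  by apply/eqP; rewrite eq_le nn andbT -nf; apply: gmin => k.
move/eqP; rewrite psumr_eq0 => [/allP g0|t _]; last exact: normc_ge0.
apply/ffunP => t; rewrite f0; apply: ComplexField.Normc.eq0_normc.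
by apply/eqP; have := g0 t (mem_index_enum t).
Qed.

(* With damping scale [A = K * ln N], [K = 512 * (2 * M + 3)], the number of
   draws is between [oversampling M - 2] and [oversampling M] times [ln N * #|T|]: the
   term [4 * K] beats the initial potential [expR (2 * A)], while [K] is large
   enough for the off-[T] exponential bound to survive that many draws. *)
Definition oversampling (R : realType) (M : R) : R :=
  4 * (512 * (2 * M + 3)) + 2 * M + 10.

Lemma mean_failure (R : realType) (M tau : R) (N : nat)
    (f : {ffun 'I_N -> R[i]}) (T : {set 'I_N}) :
    0 < M -> (2 <= N)%N -> 0 <= tau <= 1 -> (0 < #|T|)%N -> supported_on f T ->
    4 * oversampling M * (ln N%:R * #|T|%:R) <= tau * N%:R ->
  \sum_(W : {set 'I_N}) bernoulli_weight tau W * failure f W <=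
    41 * expR (- (M * ln N%:R)).
Proof.
move=> M0 N2 t01 T0 fT; set L : R := ln N%:R; set s : R := #|T|%:R => tN.
have L_ge : 1 / 2 <= L := ln_nat_ge_half R N2.
have s1 : 1 <= s by rewrite ler1n.
have N0 : (0 < N)%N by exact: ltnW.
have NR : N%:R = expR L by rewrite lnK// posrE ltr0n.
have sN : s <= N%:R by rewrite ler_nat -[leqRHS]card_ord max_card.
rewrite /oversampling in tN; set K := 512 * (2 * M + 3) in tN.
have K0 : 0 < K by rewrite /K; lra.
have Ls : 1 / 2 <= L * s by nra.
(* The window has length 2 L s >= 1, so it contains an integer. *)
have [m xm mx] : exists2 m : nat, (4 * K + 2 * M + 8) * (L * s) <= m%:R &
    m%:R <= (4 * K + 2 * M + 10) * (L * s).
  set x := (4 * K + 2 * M + 8) * (L * s).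
  have x0 : 0 <= x by rewrite /x mulr_ge0; lra.
  have /andP[mx xm] := truncn_itv x0.
  exists (Num.truncn x).+1; first exact: ltW.
  by rewrite -natr1; rewrite /x in mx *; lra.
have A0 : 0 < K * L by rewrite mulr_gt0//; lra.
have l0 : 0 <= K * L / 64 by rewrite divr_ge0// ltW.
have lA : K * L / 64 / (K * L) = 1 / 64.
  by field; rewrite -?mulf_eq0 !lt0r_neq0//; lra.
have lA_le : K * L / 64 / (K * L) <= 1 / 2 by rewrite lA; lra.
apply: (le_trans (bernoulli_mean_le (failure_ge0 f) (failure_le1 f)
  (@failure_sub _ _ f) m t01 N0)).
have draws := draw_mean_failure T0 fT A0 l0 lA_le m.
rewrite lA -/s in draws.
have KE : K = 512 * (2 * M + 3) by [].
clearbody K L s.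
have N1 : N.+1%:R <= 2 * N%:R :> R.
  by rewrite -natrM ler_nat mul2n -addnn -addn1 leq_add2l.
(* By the factor 4 in the hypothesis, tau N / 2 is at least twice the upper bound on m. *)
have tail : expR (m%:R - tau * N%:R / 2) <= expR (- (M * L)).
  rewrite ler_expR.
  have LsL : L <= L * s by rewrite ler_peMr//; lra.
  have : M * L <= M * (L * s) by rewrite ler_wpM2l// ltW.
  have : 0 <= (4 * K + M + 10) * (L * s) by rewrite mulr_ge0; lra.
  lra.
have ms_ge : (4 * K + 2 * M + 8) * L <= m%:R / s.
  by rewrite ler_pdivlMr -?mulrA//; lra.
have ms_le : m%:R / s <= (4 * K + 2 * M + 10) * L.
  by rewrite ler_pdivrMr -?mulrA//; lra.
(* The exponent m/(2s) is at least (2K + M + 4)L: 2K cancels the initial potential, 3 pays for N^2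
   s, and M + 1 remains. The spare 1/N pays for the N + 1 targets. *)
have on : 16 * N%:R ^+ 2 * s * expR (2 * (K * L)) * expR (- (2 * s)^-1) ^+ m <=
    16 * (expR (- (M * L)) / N%:R).
  have -> : expR (- (2 * s)^-1) ^+ m = expR (- (m%:R / s / 2)).
    by rewrite -expRM_natl; congr expR; field; rewrite lt0r_neq0//; lra.
  apply: (@le_trans _ _ (16 * (N%:R ^+ 3 * (expR (2 * (K * L)) *
      expR (- (m%:R / s / 2)))))).
    set q := expR (2 * (K * L)); set q' := expR (- (_ / 2)).
    have q0 : 0 <= 16 * N%:R ^+ 2 * (q * q').
      apply: mulr_ge0; first by rewrite mulr_ge0// exprn_ge0.
      by rewrite mulr_ge0 ?expR_ge0.
    by have := ler_wpM2l q0 sN; congr (_ <= _); ring.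
  rewrite ler_wpM2l// NR -expRM_natl -!expRD -expRN -expRD ler_expR; lra.
(* With l = A/64 the threshold gains KL/256, while the draws cost about KL/512; the surplus KL/512 =
   (2M + 3)L absorbs the lower-order terms and the powers of N. *)
have off : 4 * N%:R * expR (2 * (1 / 64) ^+ 2 / s) ^+ m *
    expR (- (K * L / 64 / 4)) <= 4 * (expR (- (M * L)) / N%:R).
  have -> : expR (2 * (1 / 64) ^+ 2 / s) ^+ m = expR (m%:R / s / 2048).
    by rewrite -expRM_natl; congr expR; field; rewrite lt0r_neq0//; lra.
  rewrite -!mulrA ler_wpM2l// NR -!expRD -expRN -expRD ler_expR.
  have : K * L = 512 * (2 * M + 3) * L by rewrite KE.
  have : 0 <= M * L by rewrite mulr_ge0//; lra.
  lra.
have : N.+1%:R * (16 * (expR (- (M * L)) / N%:R) +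
    4 * (expR (- (M * L)) / N%:R)) <= 40 * expR (- (M * L)).
  have -> : 40 * expR (- (M * L)) = 2 * N%:R *
      (16 * (expR (- (M * L)) / N%:R) + 4 * (expR (- (M * L)) / N%:R)).
    by field; rewrite pnatr_eq0 -lt0n.
  by rewrite ler_wpM2r// addr_ge0 ?mulr_ge0 ?divr_ge0 ?expR_ge0.
have := ler_wpM2l (ler0n R N.+1) (lerD on off).
lra.
Qed.

Theorem theorem1p3 (R : realType) (M : R) (hM : 0 < M) :
  exists alpha C : R, [/\ 0 < alpha, 0 < C &
    forall (N : nat) (tau : R) (f : {ffun 'I_N -> R[i]}) (T : {set 'I_N})
      (d : measure_display) (S : measurableType d) (P : probability S R)
      (Omega : S -> {set 'I_N}),
    (2 <= N)%N -> 0 < tau -> tau < 1 ->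
    bernoulli_random_set P tau Omega ->
    supported_on f T ->
    #|T|%:R <= alpha * (ln N%:R)^-1 * (tau * N%:R) ->
    (P [set w | l1_minimizers f (Omega w) = [set f]]
       >= (1 - C * N%:R `^ (- M))%:E)%E].
Proof.
have D0 : 0 < 4 * oversampling M by rewrite /oversampling; lra.
(* 41 is 1 for the Bernoulli tail plus 2 (16 + 4) for the draws, the 2 coming from N + 1 <= 2N. *)
exists (4 * oversampling M)^-1, 41; split => //; first by rewrite invr_gt0.
move=> N tau f T d S P Omega N2 t0 t1 bernoulli fT Ts.
pose bad : pred {set 'I_N} := fun W => `[< l1_minimizers f W <> [set f] >].
have powN : N%:R `^ (- M) = expR (- (M * ln N%:R)) :> R.
  by rewrite /powR pnatr_eq0 -leqn0 leqNgt (ltnW N2) mulNr.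
have mean_bad : \sum_(W : {set 'I_N}) bernoulli_weight tau W * (bad W)%:R <=
    41 * N%:R `^ (- M).
  rewrite powN; have [T0|T0] := posnP #|T|.
    rewrite big1 ?mulr_ge0 ?expR_ge0// => W _.
    rewrite /bad l1_minimizers0; first by case: asboolP; rewrite ?mulr0.
    by move=> t; apply: fT; rewrite (cards0_eq T0) inE.
  apply: (mean_failure (T := T)) => //; first by rewrite !ltW.
  have L0 : 0 < ln N%:R :> R.
    by apply: lt_le_trans (ln_nat_ge_half R N2); lra.
  by move: Ts; rewrite -mulrA ler_pdivlMl// ler_pdivlMl// mulrCA.
have -> : [set w | l1_minimizers f (Omega w) = [set f]] =
    ~` [set w | bad (Omega w)].
  apply/seteqP; split => w /=; rewrite /bad.
    by move=> fW; case: asboolP.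
  by move=> /negP/asboolPn/contrapT.
have bad_meas := measurable_random_set bernoulli bad.
rewrite probability_setC//.
have := random_set_prob_le bernoulli bad.
have : P [set w | bad (Omega w)] \is a fin_num by exact: fin_num_measure.
case: (P [set w | bad (Omega w)]) => // p _; rewrite lee_fin => p_le.
rewrite -EFinB lee_fin; lra.
Qed.
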